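(* Let $f_1,f_2\in\mathbb{R}[x,y]$ be square-free polynomials of the same degree defining curves that are neither unions of parallel lines nor unions of concentric circles, and suppose that $\mathbf{Sim}(f_1,f_2)\neq\emptyset$. Assume that for some $\ell$ we have $\triangle^\ell f_1=x$ and that $\triangle^\ell f_2=ax+by+c$ has degree $1$. Fix a similarity $\phi=(\phi_1,\phi_2)\in\mathbf{Sim}(f_1,f_2)$ with scaling factor $\mu$. Let $k$ be the smallest natural number such that $\triangle^kf_1=p_1(x)$ depends only on $x$ (then $k$ is also the smallest natural number such that $\triangle^kf_2$ is a univariate polynomial composed with $\phi_1(x,y)$), and write $\triangle^kf_2=p_2(x,y)=\omega(\phi_1(x,y))$ with $\omega$ a univariate polynomial. Let $\widehat f_i=\triangle^{k-1}f_i$ for $i=1,2$. Let $\tilde p_1(x)$ be the polynomial with $\tilde p_1''=p_1$ and $\tilde p_1(0)=\tilde p_1'(0)=0$; let $\tilde\omega$ be the univariate polynomial with $\tilde\omega''=\omega$ and $\tilde\omega(0)=\tilde\omega'(0)=0$, and let $\tilde p_2(x,y)=\frac{1}{\mu^2}\tilde\omega(\phi_1(x,y))$. Let $h_i=\widehat f_i-\tilde p_i$ for $i=1,2$. Then $\mathbf{Sim}(f_1,f_2)\subset\mathbf{Sim}(h_1,h_2)$.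
   Context: $\triangle f=\partial_x^2 f+\partial_y^2 f$ is the Laplacian, and $\triangle^j$ denotes its $j$-fold iterate. A similarity of the plane is a map $X\mapsto \mu AX+b$ with $\mu\in\mathbb{R}\setminus\{0\}$ (the scaling factor), $A$ a real orthogonal $2\times2$ matrix and $b\in\mathbb{R}^2$. $\mathbf{Sim}(f_1,f_2)$ is the set of similarities $\phi$ of the plane such that $f_1\circ\phi=\lambda f_2$ for some constant $\lambda\neq0$. Since the curve $f_1=0$ is not a union of parallel lines, $k\ge1$. Because $\triangle^\ell f_1\circ\phi$ is a nonzero constant multiple of $\triangle^\ell f_2$, $\phi_1$ is a nonzero constant multiple of $ax+by+c$. Curves are considered as zero sets in $\mathbb{C}^2$. *)

(* Defs.v *)
From HB Require Import structures.
From mathcomp Require Import all_boot all_order all_algebra.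
From mathcomp Require Import boolp classical_sets reals.
From mathcomp Require Import complex.
From mathcomp Require Import mpoly.

Set Implicit Arguments.
Unset Strict Implicit.
Unset Printing Implicit Defensive.

Import Order.TTheory GRing.Theory Num.Theory.

Local Open Scope classical_set_scope.
Local Open Scope ring_scope.

(* R[x, y] is {mpoly R[2]}, with x = 'X_(ord0) and y = 'X_(ord_max); the total
   degree of a nonzero f is (msize f).-1. *)
Section Bivariate.
Variable R : realType.
Implicit Types (f q : {mpoly R[2]}) (w : {poly R}) (phi : 2.-tuple {mpoly R[2]}).

Definition xvar : {mpoly R[2]} := 'X_(ord0 : 'I_2).
Definition yvar : {mpoly R[2]} := 'X_(ord_max : 'I_2).

Definition laplacian f : {mpoly R[2]} :=
  mderiv ord0 (mderiv ord0 f) + mderiv ord_max (mderiv ord_max f).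

(* Forces f != 0, since 0 = 'X_i ^+ 2 * 0. *)
Definition square_free f : Prop :=
  forall g h : {mpoly R[2]}, f = g ^+ 2 * h -> (msize g <= 1)%N.

(* w(q(x, y)) *)
Definition ucomp w q : {mpoly R[2]} := (map_poly (@mpolyC 2 R) w).[q].

Definition univariate_in q f : Prop := exists w : {poly R}, f = ucomp w q.

(* Points of C^2 are functions 'I_2 -> R[i], as in mpoly's evaluation. *)
Definition complex_zeros f : set ('I_2 -> R[i]) :=
  [set z | (map_mpoly (real_complex R) f).@[z] = 0].

Definition complex_line (u v c : R[i]) : set ('I_2 -> R[i]) :=
  [set z | u * z ord0 + v * z ord_max = c].

(* s is the squared radius; over C it may be any number, zero included. *)
Definition complex_circle (u v s : R[i]) : set ('I_2 -> R[i]) :=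
  [set z | (z ord0 - u) ^+ 2 + (z ord_max - v) ^+ 2 = s].

Definition union_of_parallel_lines f : Prop :=
  exists (u v : R[i]) (D : set R[i]), (u, v) <> (0, 0) /\
    complex_zeros f = \bigcup_(c in D) complex_line u v c.

Definition union_of_concentric_circles f : Prop :=
  exists (u v : R[i]) (D : set R[i]),
    complex_zeros f = \bigcup_(s in D) complex_circle u v s.

(* A similarity X |-> mu A X + b is identified with the pair of its coordinate
   polynomials; this determines the map, hence mu up to sign. *)
Definition similarity_with_factor (mu : R) phi : Prop :=
  mu != 0 /\
  exists (A : 'M[R]_2) (b : 'cV[R]_2), A^T *m A = 1%:M /\
    forall i, tnth phi i =
      mu *: (\sum_(j < 2) A i j *: ('X_j : {mpoly R[2]})) + (b i ord0)%:MP.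

Definition similarity phi : Prop := exists mu, similarity_with_factor mu phi.

Definition Sim f1 f2 : set (2.-tuple {mpoly R[2]}) :=
  [set phi | similarity phi /\
    exists lambda : R, lambda != 0 /\ f1 \mPo phi = lambda *: f2].

End Bivariate.

Definition is_least (P : nat -> Prop) (k : nat) : Prop :=
  P k /\ forall j, P j -> (k <= j)%N.

Arguments xvar {R}.
Arguments yvar {R}.

(* Main.v *)
(* Similarities scale the Laplacian: Δ(f ∘ φ) = μ² (Δf) ∘ φ.  Hence f1 ∘ φ = λ f2
   gives Δ^j f1 ∘ φ = λ μ^(-2j) Δ^j f2 for all j, and since Δ^l f1 = x, the first
   coordinates of any two elements φ, ψ of Sim(f1, f2) are proportional:
   ψ_1 = t φ_1, whence ν² = t² μ² on comparing gradients.  Applying this with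
   j = k gives p1(t z) = λ' ν^(-2k) ω(z), as φ_1 is not constant.  Integrating
   twice from 0, both double primitives get multiplied by compatible factors, and
   λ' ν^(-2(k-1)) is the common ratio of h1 ∘ ψ to h2.  That k ≥ 1 holds because
   f1 = p1(x) would be a union of vertical lines. *)

Require Import Defs.
From HB Require Import structures.
From mathcomp Require Import all_boot all_order all_algebra.
From mathcomp Require Import boolp classical_sets reals.
From mathcomp Require Import complex.
From mathcomp Require Import mpoly.

Set Implicit Arguments.
Unset Strict Implicit.
Unset Printing Implicit Defensive.

Import Order.TTheory GRing.Theory Num.Theory.

Local Open Scope classical_set_scope.
Local Open Scope ring_scope.

(** * Induction over ring operations, composition and derivatives of polynomials *)

Lemma mpoly_ring_ind (n : nat) (R : comNzRingType) (P : {mpoly R[n]} -> Prop) :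
  (forall c, P c%:MP) -> (forall i, P 'X_i) ->
  (forall p q, P p -> P q -> P (p + q)) ->
  (forall p q, P p -> P q -> P (p * q)) -> forall p, P p.
Proof.
move=> PC PX PD PM; elim/mpolyind=> [|c m p _ _ Pp]; first by rewrite -mpolyC0.
apply: PD => //; rewrite -mul_mpolyC; apply: (PM) => //.
rewrite mpolyXE_id; apply: (big_ind P) => [|p1 q1|i _]; [| exact: PM |].
  by rewrite -mpolyC1.
elim: (m i) => [|d IHd]; first by rewrite expr0 -mpolyC1.
by rewrite exprS; apply: (PM).
Qed.

Lemma mderivXU (n : nat) (R : nzRingType) (i j : 'I_n) :
  mderiv i ('X_j : {mpoly R[n]}) = (j == i)%:R%:MP.
Proof.
rewrite mderivX mnm1E; case: eqVneq => [->|_]; last by rewrite scale0r mpolyC0.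
by rewrite scale1r -{1}[U_(i)%MM]add0m addmK mpolyX0 mpolyC1.
Qed.

(** The chain rule. Constants and variables are immediate, and the formula is stable under sums and,
    by the Leibniz rule, under products. *)
Lemma mderiv_comp_mpoly (n k : nat) (R : comNzRingType) (p : {mpoly R[n]})
    (lq : n.-tuple {mpoly R[k]}) (i : 'I_k) :
  mderiv i (p \mPo lq) =
  \sum_(j < n) (mderiv j p \mPo lq) * mderiv i (tnth lq j).
Proof.
elim/mpoly_ring_ind: p => [c|j|p q IHp IHq|p q IHp IHq].
- rewrite comp_mpolyC mderivC big1 // => j _.
  by rewrite mderivC comp_mpoly0 mul0r.
- rewrite comp_mpolyXU -tnth_nth (bigD1 j) //= big1 => [|m /negbTE neq_mj].
    by rewrite mderivXU eqxx comp_mpolyC mpolyC1 mul1r addr0.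
  by rewrite mderivXU eq_sym neq_mj comp_mpolyC mpolyC0 mul0r.
- rewrite comp_mpolyD mderivD IHp IHq -big_split; apply: eq_bigr => j _ /=.
  by rewrite mderivD comp_mpolyD mulrDl.
- rewrite rmorphM mderivM IHp IHq mulr_suml mulr_sumr -big_split.
  apply: eq_bigr => j _ /=; rewrite mderivM comp_mpolyD !rmorphM mulrDl.
  by rewrite mulrAC mulrA.
Qed.

(** The composite substitution is a ring morphism fixing constants, so it is the identity once it
    fixes the variables. *)
Lemma comp_mpoly_cancel (n k : nat) (R : comNzRingType)
    (lp : n.-tuple {mpoly R[k]}) (lq : k.-tuple {mpoly R[n]}) :
  (forall i, tnth lp i \mPo lq = 'X_i) ->
  cancel (comp_mpoly lp) (comp_mpoly lq).
Proof.
move=> lpK; elim/mpoly_ring_ind=> [c|i|p q IHp IHq|p q IHp IHq].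
- by rewrite !comp_mpolyC.
- by rewrite comp_mpolyXU -tnth_nth lpK.
- by rewrite !comp_mpolyD IHp IHq.
- by rewrite !rmorphM /= IHp IHq.
Qed.

(** Uniqueness of primitives in characteristic zero; applied twice, it identifies double primitives
    with vanishing initial data. *)
Lemma eq_deriv_horner0 (R : numDomainType) (p q : {poly R}) :
  p^`() = q^`() -> p.[0] = q.[0] -> p = q.
Proof.
move=> eq_d eq0; apply/polyP => -[|i]; first by rewrite -!horner_coef0.
have := congr1 (fun r : {poly R} => r`_i) eq_d.
by rewrite !coef_deriv => /eqP; rewrite eqrMn2r => /eqP.
Qed.

Section Bivariate.
Variable R : realType.
Implicit Types (f q : {mpoly R[2]}) (w v : {poly R}).
Implicit Types (phi psi : 2.-tuple {mpoly R[2]}).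

Local Notation lap := (@laplacian R).

(** * Univariate polynomials composed with a bivariate one *)

Lemma ucompZ (c : R) w q : ucomp (c *: w) q = c *: ucomp w q.
Proof. by rewrite /ucomp map_polyZ hornerZ mul_mpolyC. Qed.

Lemma ucomp_comp w v q : ucomp (w \Po v) q = ucomp w (ucomp v q).
Proof. by rewrite /ucomp map_comp_poly horner_comp. Qed.

Lemma ucomp_scaleX w (c : R) q : ucomp (w \Po (c *: 'X)) q = ucomp w (c *: q).
Proof.
by rewrite ucomp_comp ucompZ; congr (ucomp _ (_ *: _)); rewrite /ucomp map_polyX hornerX.
Qed.

Lemma ucomp_comp_mpoly w q phi : ucomp w q \mPo phi = ucomp w (q \mPo phi).
Proof.
rewrite /ucomp -[LHS]horner_map /= -map_poly_comp; congr (_.[_]).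
by apply: eq_map_poly => c /=; rewrite comp_mpolyC.
Qed.

Lemma xvar_comp_mpoly phi : (xvar : {mpoly R[2]}) \mPo phi = tnth phi ord0.
Proof. by rewrite comp_mpolyXU -tnth_nth. Qed.

Lemma ucomp_xvar_inj : injective (fun w => ucomp w (xvar : {mpoly R[2]})).
Proof.
(* Sending both variables to ['X] gives a left inverse of [w] |-> [w(x)]. *)
pose g := mmap (@polyC R) (fun _ : 'I_2 => 'X).
suff gK w : g (ucomp w xvar) = w by move=> w v /(congr1 g); rewrite !gK.
rewrite /g /ucomp -horner_map /= -map_poly_comp mmapX mmap1U.
rewrite (eq_map_poly (g := polyC)) => [|c /=]; last by rewrite mmapC.
by have := comp_polyXr w; rewrite /comp_poly.
Qed.

Lemma univariate_in_xvar_union_of_parallel_lines f :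
  univariate_in xvar f -> union_of_parallel_lines f.
Proof.
move=> [w ->]; pose W := map_poly (real_complex R) w.
(* The lines are x = c for the complex roots c of [w]; if [w] is zero, every c occurs. *)
exists 1, 0, [set c | W.[c] = 0]; split; first by case=> /eqP; rewrite oner_eq0.
have eval (z : 'I_2 -> R[i]) :
    (map_mpoly (real_complex R) (ucomp w xvar)).@[z] = W.[z ord0].
  rewrite /ucomp -[in LHS]horner_map -[in LHS]horner_map /=.
  rewrite map_mpolyX mevalXU -!map_poly_comp; congr (_.[_]).
  by apply: eq_map_poly => c /=; rewrite map_mpolyC mevalC.
apply/seteqP; split=> [z /= | z /= [c + zc]]; rewrite /complex_zeros /= eval.
  by move=> Wz; exists (z ord0); rewrite // /complex_line /= mul1r mul0r addr0.
by rewrite -zc mul1r mul0r addr0.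
Qed.

(** * Laplacians under similarities, and cancellation of similarities *)

Lemma laplacianE f : lap f = \sum_(i < 2) mderiv i (mderiv i f).
Proof.
rewrite /laplacian big_ord_recl big_ord1.
by congr (_ + mderiv _ (mderiv _ _)); apply: val_inj.
Qed.

Lemma laplacianZ (c : R) f : lap (c *: f) = c *: lap f.
Proof. by rewrite /laplacian !mderivZ scalerDr. Qed.

Lemma iter_laplacianZ j (c : R) f : iter j lap (c *: f) = c *: iter j lap f.
Proof. by elim: j => //= j ->; rewrite laplacianZ. Qed.

Lemma mderiv_affine (mu : R) (A : 'M[R]_2) (b : 'cV[R]_2) phi i j :
  (forall i, tnth phi i =
      mu *: (\sum_(j < 2) A i j *: ('X_j : {mpoly R[2]})) + (b i ord0)%:MP) ->
  mderiv j (tnth phi i) = (mu * A i j)%:MP.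
Proof.
move=> ->; rewrite mderivD mderivC addr0 mderivZ (linear_sum (mderiv j)) (bigD1 j) //= big1.
  by rewrite mderivZ mderivXU eqxx addr0 scalerA mpolyC1 alg_mpolyC.
by move=> m /negbTE neq_mj; rewrite mderivZ mderivXU neq_mj mpolyC0 scaler0.
Qed.

(** The hypothesis makes the columns orthonormal; a left inverse of a square matrix is also a right
    inverse, which gives the rows. *)
Lemma orthogonal_rows (A : 'M[R]_2) i j :
  A^T *m A = 1%:M -> \sum_m A i m * A j m = (i == j)%:R.
Proof.
move=> /mulmx1C /matrixP /(_ i j); rewrite !mxE => <-.
by apply: eq_bigr => m _; rewrite mxE.
Qed.

Lemma laplacian_comp_similarity (mu : R) f phi :
  similarity_with_factor mu phi ->
  lap (f \mPo phi) = mu ^+ 2 *: (lap f \mPo phi).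
Proof.
move=> [_ [A [b [AA phiE]]]].
have dE i g : mderiv i (g \mPo phi) =
    \sum_(j < 2) (mu * A j i) *: (mderiv j g \mPo phi).
  rewrite mderiv_comp_mpoly; apply: eq_bigr => j _.
  by rewrite (mderiv_affine _ _ phiE) mulrC mul_mpolyC.
have ddE i : mderiv i (mderiv i (f \mPo phi)) = \sum_(j < 2) \sum_(m < 2)
    (mu ^+ 2 * (A j i * A m i)) *: (mderiv m (mderiv j f) \mPo phi).
  rewrite dE (linear_sum (mderiv i)); apply: eq_bigr => j _ /=.
  rewrite mderivZ dE scaler_sumr; apply: eq_bigr => m _.
  by rewrite scalerA mulrACA expr2.
rewrite !laplacianE (eq_bigr _ (fun i _ => ddE i)) exchange_big (linear_sum (comp_mpoly phi)) /=.
(* With the sum over [i] innermost, orthonormality of the rows of [A] kills the mixed second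
   derivatives and leaves the factor [mu ^+ 2] on the diagonal ones. *)
rewrite scaler_sumr; apply: eq_bigr => j _; rewrite exchange_big (bigD1 j) //=.
rewrite -scaler_suml -mulr_sumr orthogonal_rows // eqxx mulr1 big1 ?addr0 //.
move=> m /negbTE neq_mj.
by rewrite -scaler_suml -mulr_sumr orthogonal_rows // eq_sym neq_mj mulr0 scale0r.
Qed.

Lemma iter_laplacian_comp_similarity j (mu : R) f phi :
  similarity_with_factor mu phi ->
  iter j lap (f \mPo phi) = (mu ^+ 2) ^+ j *: (iter j lap f \mPo phi).
Proof.
move=> simphi; elim: j => [|j IHj] /=; first by rewrite expr0 scale1r.
by rewrite IHj laplacianZ (laplacian_comp_similarity _ simphi) scalerA -exprSr.
Qed.

Lemma iter_laplacian_Sim (mu lambda : R) f1 f2 phi j :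
  similarity_with_factor mu phi -> f1 \mPo phi = lambda *: f2 ->
  iter j lap f1 \mPo phi = (lambda / (mu ^+ 2) ^+ j) *: iter j lap f2.
Proof.
move=> simphi /(congr1 (iter j lap)).
rewrite (iter_laplacian_comp_similarity _ _ simphi) iter_laplacianZ.
have mu0 : (mu ^+ 2) ^+ j != 0 by rewrite !expf_neq0 //; case: simphi.
move=> /(congr1 (GRing.scale ((mu ^+ 2) ^+ j)^-1)).
by rewrite !scalerA mulVf // scale1r mulrC.
Qed.

Lemma comp_similarity_inj phi : similarity phi -> injective (comp_mpoly phi).
Proof.
move=> [mu [mu0 [A [b [AA phiE]]]]].
(* [psi] is the inverse similarity X |-> mu^-1 A^T (X - b). *)
pose Y m : {mpoly R[2]} := 'X_m - (b m ord0)%:MP.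
pose psi := [tuple \sum_(m < 2) (mu^-1 * A m j) *: Y m | j < 2].
apply: (can_inj (comp_mpoly_cancel (lq := psi) _)) => i.
rewrite phiE comp_mpolyD comp_mpolyC comp_mpolyZ (linear_sum (comp_mpoly psi)) /=.
suff -> : \sum_(j < 2) ((A i j *: 'X_j) \mPo psi) = mu^-1 *: Y i.
  by rewrite scalerA mulfV // scale1r subrK.
have jE j : (A i j *: 'X_j) \mPo psi =
    \sum_(m < 2) (mu^-1 * (A i j * A m j)) *: Y m.
  rewrite comp_mpolyZ comp_mpolyXU -tnth_nth tnth_mktuple scaler_sumr.
  by apply: eq_bigr => m _; rewrite scalerA mulrCA.
rewrite (eq_bigr _ (fun j _ => jE j)) exchange_big (bigD1 i) //=.
rewrite -scaler_suml -mulr_sumr orthogonal_rows // eqxx mulr1 big1 ?addr0 //.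
move=> m /negbTE neq_mi.
by rewrite -scaler_suml -mulr_sumr orthogonal_rows // eq_sym neq_mi mulr0 scale0r.
Qed.

Lemma similarity_factor_scale (mu nu t : R) phi psi :
  similarity_with_factor mu phi -> similarity_with_factor nu psi ->
  tnth psi ord0 = t *: tnth phi ord0 -> nu ^+ 2 = t ^+ 2 * mu ^+ 2.
Proof.
(* The gradient of the first coordinate is the constant vector mu' times the first row of A, of
   squared length mu'^2. *)
have grad mu' phi' : similarity_with_factor mu' phi' -> exists2 a : 'I_2 -> R,
    (forall i, mderiv i (tnth phi' ord0) = (a i)%:MP) & \sum_i a i ^+ 2 = mu' ^+ 2.
  move=> [_ [A [b [AA phiE]]]]; exists (fun i => mu' * A ord0 i) => [i|].
    exact: mderiv_affine phiE.
  under eq_bigr do rewrite exprMn [A _ _ ^+ 2]expr2.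
  by rewrite -mulr_sumr orthogonal_rows // eqxx mulr1.
move=> /grad[a da <-] /grad[a' da' <-] psiE; rewrite mulr_sumr.
apply: eq_bigr => i _; rewrite -exprMn; congr (_ ^+ 2).
apply: (can_inj (@mpolyCK 2 R)).
by rewrite -da' psiE mderivZ da -mul_mpolyC mpolyCM.
Qed.

End Bivariate.

(** * Comparison of an arbitrary element of [Sim f1 f2] with the fixed [phi] *)

Theorem proposition32 (R : realType) (f1 f2 : {mpoly R[2]})
  (sqf1 : square_free f1) (sqf2 : square_free f2)
  (same_deg : msize f1 = msize f2)
  (nlines1 : ~ union_of_parallel_lines f1)
  (nlines2 : ~ union_of_parallel_lines f2)
  (ncircles1 : ~ union_of_concentric_circles f1)
  (ncircles2 : ~ union_of_concentric_circles f2)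
  (Sim_neq0 : Sim f1 f2 !=set0)
  (l : nat) (a b c : R)
  (lap_l_f1 : iter l (@laplacian R) f1 = xvar)
  (lap_l_f2 : iter l (@laplacian R) f2 = a *: xvar + b *: yvar + c%:MP)
  (deg_lap_l_f2 : msize (iter l (@laplacian R) f2) = 2%N)
  (phi : 2.-tuple {mpoly R[2]}) (mu : R)
  (Sim_phi : Sim f1 f2 phi) (mu_phi : similarity_with_factor mu phi)
  (k : nat)
  (k_least : is_least (fun j => univariate_in xvar (iter j (@laplacian R) f1)) k) :
  is_least
    (fun j => univariate_in (tnth phi ord0) (iter j (@laplacian R) f2)) k /\
  forall (p1 omega pt1 omegat : {poly R}),
    iter k (@laplacian R) f1 = ucomp p1 xvar ->
    iter k (@laplacian R) f2 = ucomp omega (tnth phi ord0) ->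
    pt1^`()^`() = p1 -> pt1.[0] = 0 -> pt1^`().[0] = 0 ->
    omegat^`()^`() = omega -> omegat.[0] = 0 -> omegat^`().[0] = 0 ->
    let fhat1 := iter k.-1 (@laplacian R) f1 in
    let fhat2 := iter k.-1 (@laplacian R) f2 in
    let ptilde1 := ucomp pt1 xvar in
    let ptilde2 := (mu ^+ 2)^-1 *: ucomp omegat (tnth phi ord0) in
    let h1 := fhat1 - ptilde1 in
    let h2 := fhat2 - ptilde2 in
    Sim f1 f2 `<=` Sim h1 h2.
Proof.
have mu0 : mu != 0 by case: mu_phi.
have phi_inj := comp_similarity_inj (ex_intro _ mu mu_phi).
case: Sim_phi => _ [lam [lam0 f1phi]].
have iphi := iter_laplacian_Sim _ mu_phi f1phi.
have c0 j : lam / (mu ^+ 2) ^+ j != 0 by rewrite mulf_neq0 ?invr_eq0 ?expf_neq0.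
(* Composition with [phi] turns x into the first coordinate of [phi]; the converse cancels [phi] by
   injectivity. Hence both least indices agree. *)
have uniE j : univariate_in xvar (iter j (@laplacian R) f1) <->
    univariate_in (tnth phi ord0) (iter j (@laplacian R) f2).
  split=> -[w wE].
    exists ((lam / (mu ^+ 2) ^+ j)^-1 *: w); rewrite ucompZ -xvar_comp_mpoly.
    by rewrite -ucomp_comp_mpoly -wE iphi scalerA mulVf ?scale1r.
  exists ((lam / (mu ^+ 2) ^+ j) *: w); apply: phi_inj.
  by rewrite ucomp_comp_mpoly xvar_comp_mpoly ucompZ -wE iphi.
case: k_least => uni_k k_min; split.
  by split=> [|j /uniE /k_min //]; apply/uniE.
move=> p1 omega pt1 omegat p1E omegaE pt1E pt1_0 dpt1_0 omegatE omegat_0 domegat_0.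
(* The case k = 0 contradicts [nlines1]. From here on [k] denotes the predecessor, so the
   polynomials [fhat1] and [fhat2] are [k]-fold Laplacians. *)
case: k uni_k {k_min} p1E omegaE => [|k] uni_k p1E omegaE.
  by case: nlines1; apply: univariate_in_xvar_union_of_parallel_lines.
move=> fhat1 fhat2 ptilde1 ptilde2 h1 h2 psi [simpsi [lam' [lam'0 f1psi]]].
split=> //; case: simpsi => nu nu_psi.
have nu0 : nu != 0 by case: nu_psi.
have ipsi := iter_laplacian_Sim _ nu_psi f1psi.
have [t psi0] : exists t, tnth psi ord0 = t *: tnth phi ord0.
  (* Ratio of the factors of [ipsi] and [iphi] at index [l], where the iterated Laplacian of [f1] is
     x. *)
  exists (lam' / (nu ^+ 2) ^+ l / (lam / (mu ^+ 2) ^+ l)).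
  by rewrite -!xvar_comp_mpoly -lap_l_f1 iphi ipsi scalerA divfK.
have nuE := similarity_factor_scale mu_phi nu_psi psi0.
pose d := lam' / (nu ^+ 2) ^+ k.+1.
have p1t : p1 \Po (t *: 'X) = d *: omega.
  (* It suffices to compare both sides at the first coordinate of [phi], where the claim is [ipsi]
     at index [k.+1]. *)
  apply: ucomp_xvar_inj; apply: phi_inj.
  rewrite !ucomp_comp_mpoly xvar_comp_mpoly ucomp_scaleX ucompZ -omegaE -psi0.
  by rewrite -ipsi p1E ucomp_comp_mpoly xvar_comp_mpoly.
have dcomp (p : {poly R}) : (p \Po (t *: 'X))^`() = t *: (p^`() \Po (t *: 'X)).
  by rewrite deriv_comp derivZ derivX mulrC alg_polyC mul_polyC.
(* Each differentiation of p(tX) produces a factor t, and all constants of integration vanish. *)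
have pt1t : pt1 \Po (t *: 'X) = (t ^+ 2 * d) *: omegat.
  apply: eq_deriv_horner0; last first.
    by rewrite horner_comp !hornerZ hornerX mulr0 pt1_0 omegat_0 mulr0.
  apply: eq_deriv_horner0; last first.
    rewrite dcomp derivZ !hornerZ horner_comp !hornerZ hornerX mulr0.
    by rewrite dpt1_0 domegat_0 !mulr0.
  by rewrite dcomp !derivZ dcomp pt1E p1t omegatE !scalerA mulrA expr2.
(* This factor is forced by [fhat1] and [fhat2]; it remains to see that [ptilde1] and [ptilde2]
   scale by it too. *)
exists (lam' / (nu ^+ 2) ^+ k); split; first by rewrite mulf_neq0 ?invr_eq0 ?expf_neq0.
rewrite /h1 comp_mpolyB ipsi scalerBr; congr (_ - _).
rewrite ucomp_comp_mpoly xvar_comp_mpoly psi0 -ucomp_scaleX pt1t ucompZ.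
have t20 : t ^+ 2 != 0.
  by apply: contra_neq (expf_neq0 2 nu0) => t20; rewrite nuE t20 mul0r.
(* The remaining identity t^2 d = lam' nu^(-2k) mu^(-2) amounts to nu^2 = t^2 mu^2. *)
rewrite scalerA; congr (_ *: _); rewrite /d [_ ^+ k.+1]exprSr invfM mulrC -!mulrA.
by congr (_ * (_ * _)); rewrite nuE invfM mulrAC mulVf // mul1r.
Qed.
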